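(* Let $\lambda$ be a partition of a positive integer $n$, let $k=\lambda_1$, and let $a_1>a_2>\dots>a_k$ be the hook lengths of the cells in the first row of $\lambda$. Then for every non-negative integer $m$, \[ E_m(\lambda)=\sum_{i=0}^{m}\binom{k-i}{m-i}S_{m-i}(m-k-1)\,\sigma_i(a_1,\dots,a_k), \] where $\sigma_i(a_1,\dots,a_k)=\sum_{1\le\iota_1<\dots<\iota_i\le k}a_{\iota_1}\cdots a_{\iota_i}$ is the $i$-th elementary symmetric polynomial ($\sigma_0=1$, and $\sigma_i=0$ for $i>k$).
   Context: Cell $(i,j)$ lies in $\lambda$ iff $j\le\lambda_i$; $h_{i,j}$ is its hook length. For the one-row partition $[m]\le\lambda$, place pebbles on cells $(1,1),\dots,(1,m)$. A local excitation move moves a pebble from $(i,j)$ to $(i+1,j+1)$ provided $(i,j+1)$, $(i+1,j)$, $(i+1,j+1)$ are unoccupied and $(i+1,j+1)$ lies in $\lambda$. Excited diagrams are the sets of occupied cells after any finite sequence of such moves, and $E_m(\lambda)=\sum_{\varepsilon}\prod_{(i,j)\in\varepsilon}h_{i,j}$ over all excited diagrams $\varepsilon$ of $[m]$ in $\lambda$; $E_0(\lambda)=1$ and $E_m(\lambda)=0$ if $m>\lambda_1$. The Stirling polynomials $S_j(x)\in\mathbb{Q}[x]$ ($j\ge0$) are defined by requiring $\binom{\ell}{j}S_j(\ell)=\sigma_j(\ell,\ell-1,\dots,1)$ for every positive integer $\ell$. Binomial coefficients $\binom{x}{j}=x(x-1)\cdots(x-j+1)/j!$ are taken as polynomials in $x$,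 so they are defined for all integers $x$. *)

(* Defs.v *)
From HB Require Import structures.
From mathcomp Require Import all_boot all_order all_algebra.
From mathcomp Require Import mpoly.
From mathcomp Require Import ring lra zify.

Set Implicit Arguments.
Unset Strict Implicit.
Unset Printing Implicit Defensive.

Import Order.TTheory GRing.Theory Num.Theory.
Local Open Scope ring_scope.

(* Rows and columns are numbered from 0: the pair (i, j) below is the cell
   (i + 1, j + 1) of the 1-based convention. *)

Definition is_partition (n : nat) (la : seq nat) : bool :=
  [&& sorted geq la, 0%N \notin la & sumn la == n].

Definition in_diagram (la : seq nat) (i j : nat) : bool :=
  (j < nth 0%N la i)%N.

Definition arm_length (la : seq nat) (i j : nat) : nat :=
  (nth 0 la i - j.+1)%N.

Definition leg_length (la : seq nat) (i j : nat) : nat :=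
  count (fun r => j < r)%N (drop i.+1 la).

Definition hook_length (la : seq nat) (i j : nat) : nat :=
  (arm_length la i j + leg_length la i j + 1)%N.

(* The bounding box of the diagram; membership in the diagram itself is
   tested with [in_diagram]. *)
Notation cell la := ('I_(size la) * 'I_(nth 0%N la 0))%type.

Section Excited.
Variable la : seq nat.
Implicit Types (D : {set cell la}) (m : nat).

Definition occupied D (i j : nat) : bool :=
  [exists c in D, (c.1 == i :> nat) && (c.2 == j :> nat)].

Definition excited_move : rel {set cell la} := fun D D' =>
  [exists c : cell la, exists c' : cell la,
    [&& c \in D,
        (c'.1 == c.1.+1 :> nat) && (c'.2 == c.2.+1 :> nat),
        in_diagram la c'.1 c'.2,
        [&& ~~ occupied D c.1 c.2.+1, ~~ occupied D c.1.+1 c.2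
          & ~~ occupied D c.1.+1 c.2.+1]
      & D' == c' |: (D :\ c)]].

Definition one_row m : {set cell la} :=
  [set c : cell la | (c.1 == 0 :> nat) && (c.2 < m)%N].

Definition excited m : {set {set cell la}} :=
  [set D | connect excited_move (one_row m) D].

Definition excited_sum m : nat :=
  if (m <= nth 0 la 0)%N
  then \sum_(D in excited m) \prod_(c in D) hook_length la c.1 c.2
  else 0%N.

End Excited.

Lemma excited_sum0 (la : seq nat) : excited_sum la 0 = 1%N.
Proof.
have r0 : one_row la 0 = set0 by apply/setP=> c; rewrite !inE ltn0 andbF.
rewrite /excited_sum leq0n (_ : excited la 0 = [set set0]).
  by rewrite big_set1 big_set0.
apply/setP=> D; rewrite !inE r0; apply/idP/eqP => [|->]; last exact: connect0.
case/connectP=> [[|D' p]] //= /andP[/existsP[c /existsP[c']]].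
by rewrite inE.
Qed.

Definition sigma (j : nat) (s : seq rat) : rat :=
  (mesym (size s) rat j).@[fun i : 'I_(size s) => s`_i].

Definition gbinom (x : rat) (j : nat) : rat :=
  (\prod_(t < j) (x - t%:R)) / j`!%:R.

Definition is_stirling_poly (j : nat) (S : {poly rat}) : Prop :=
  forall l : nat, (0 < l)%N ->
    'C(l, j)%:R * S.[l%:R] = sigma j [seq i%:R | i <- rev (iota 1 l)].

Lemma sigma0 s : sigma 0 s = 1.
Proof. by rewrite /sigma mesym0E meval1. Qed.

Lemma sigma_gt j s : (size s < j)%N -> sigma j s = 0.
Proof. by move=> h; rewrite /sigma mesym_geqnE // meval0. Qed.

Lemma sigma_coef j s : (j <= size s)%N ->
  (\prod_(c <- s) ('X - c%:P))`_(size s - j) = (-1) ^+ j * sigma j s.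
Proof.
rewrite -ltnS => h; have /= := mroots_coeff (in_tuple s) (Ordinal h).
move=> ->; congr (_ * _); apply: meval_eq => i.
by rewrite (tnth_nth 0).
Qed.

Lemma sigma_cons j c s :
  sigma j.+1 (c :: s) = sigma j.+1 s + c * sigma j s.
Proof.
have [lt|le] := ltnP (size s) j.
  by rewrite !sigma_gt ?mulr0 ?addr0 //= ltnW.
have sg : (-1 : rat) ^+ j.+1 != 0 by rewrite signr_eq0.
apply: (mulfI sg); rewrite -sigma_coef // big_cons /= subSS mulrBl coefB.
rewrite coefXM coefCM sigma_coef // mulrDr.
have -> : (-1) ^+ j.+1 * (c * sigma j s) = - (c * ((-1) ^+ j * sigma j s)).
  by rewrite exprS; ring.
congr (_ + _); have [->|ne] := eqVneq j (size s).
  by rewrite subnn eqxx sigma_gt ?mulr0.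
have lt : (j < size s)%N by rewrite ltn_neqAle ne.
by rewrite subn_eq0 leqNgt lt /= -sigma_coef // -subnS.
Qed.

Lemma sigma_nil j : sigma j [::] = (j == 0)%:R.
Proof. by case: j => [|j]; rewrite ?sigma0 // sigma_gt. Qed.

Lemma sigma_down j l :
  sigma j.+1 [seq i%:R | i <- rev (iota 1 l.+1)] =
  sigma j.+1 [seq i%:R | i <- rev (iota 1 l)]
  + l.+1%:R * sigma j [seq i%:R | i <- rev (iota 1 l)].
Proof.
have -> : iota 1 l.+1 = iota 1 l ++ [:: l.+1] by rewrite -(addn1 l) iotaD add1n addn1.
by rewrite rev_cat /= sigma_cons.
Qed.

Section StirlingExistence.

Let shift (p : {poly rat}) := p \Po ('X - 1).
Let L (j : nat) (p : {poly rat}) := 'X * p - ('X - j%:R%:P) * shift p.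

Lemma size_lin_mul (c : rat) d (r : {poly rat}) :
  (size r <= d.-1)%N -> (size (('X - c%:P) * r)%R <= d)%N.
Proof.
have [->|r0] := eqVneq r 0; first by rewrite mulr0 size_poly0.
rewrite size_monicM ?monicXsubC // size_XsubC addSn add1n.
by rewrite -size_poly_gt0 in r0; case: d => //=; rewrite leqNgt r0.
Qed.

Lemma shift_monom d : {r : {poly rat} | (size r <= d.-1)%N &
  ('X - 1) ^+ d = 'X^d - d%:R *: 'X^(d.-1) + r}.
Proof.
elim: d => [|d [r sr IH]].
  by exists 0; rewrite ?size_poly0 // scale0r subr0 addr0 !expr0.
exists (('X - 1) * r + d%:R *: 'X^(d.-1)).
  rewrite (leq_trans (size_polyD _ _)) // geq_max; apply/andP; split.
    exact: size_lin_mul.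
  case: d {IH sr} => [|d]; first by rewrite scale0r size_poly0.
  by rewrite (leq_trans (size_scale_leq _ _)) // size_polyXn.
rewrite exprS IH; case: d {IH sr} => [|d] /=.
  by rewrite !scale0r !expr0 expr1 scale1r; ring.
by rewrite -!mul_polyC !exprS polyC_natr; ring.
Qed.

Lemma solve_L j d (q : {poly rat}) : (0 < j)%N -> (size q <= d)%N ->
  {p : {poly rat} | L j p = q}.
Proof.
move=> j0; elim: d q => [|d IH] q sq.
  exists 0; rewrite /L /shift comp_poly0 !mulr0 subr0.
  by apply/esym/eqP; rewrite -size_poly_leq0.
pose a : rat := q`_d / (d + j)%:R.
have [r sr rE] := shift_monom d.
have dj0 : (d + j)%:R != 0 :> rat by rewrite pnatr_eq0; lia.
have LE : L j (a *: 'X^d) =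
  q`_d *: 'X^d - a *: ((j * d)%:R *: 'X^(d.-1) + ('X - j%:R%:P) * r).
  have -> : q`_d = a * (d + j)%:R by rewrite /a divfK.
  rewrite /L /shift comp_polyZ comp_Xn_poly rE -!mul_polyC !polyCM !polyC_natr.
  case: d {IH sq sr rE dj0} @a => [|d] a /=; first by rewrite !expr0 !muln0; ring.
  by rewrite !exprS; ring.
have [|p pE] := IH (q - L j (a *: 'X^d)).
  apply/leq_sizeP => i di; rewrite LE !(coefD, coefN, coefZ, coefXn).
  have -> : (('X - j%:R%:P) * r)`_i = 0.
    apply: (leq_sizeP _ _ _ _ di).
    exact: size_lin_mul.
  have [->|nid] := eqVneq i d.
    have [d0|_] := eqVneq d d.-1; last by rewrite mulr0 mulr1; ring.
    have jd : (j * d = 0)%N by lia.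
    by rewrite jd mul0r mulr1; ring.
  have -> : q`_i = 0 by apply: (leq_sizeP _ _ sq); lia.
  have -> : (i == d.-1) = false by lia.
  by rewrite !mulr0; ring.
exists (a *: 'X^d + p); rewrite -[RHS](subrK (L j (a *: 'X^d))) -pE.
by rewrite /L /shift comp_polyD; ring.
Qed.

(* The solution S of x S(x) - (x - j) S(x - 1) = j x S_{j-1}(x - 1), an
   equation which follows from the recurrence
   sigma_j(l, ..., 1) = sigma_j(l-1, ..., 1) + l sigma_{j-1}(l-1, ..., 1). *)
Lemma stirling_poly_exists (j : nat) :
  {S : {poly rat} | is_stirling_poly j S}.
Proof.
suff [S hS] : {S : {poly rat} | forall l : nat,
    'C(l, j)%:R * S.[l%:R] = sigma j [seq i%:R | i <- rev (iota 1 l)]}.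
  by exists S => l _; exact: hS.
elim: j => [|j [T hT]].
  by exists 1 => l; rewrite bin0 hornerC mulr1 sigma0.
have [S SE] := solve_L (ltn0Sn j) (leqnn (size (j.+1%:R *: ('X * shift T)))).
exists S; elim=> [|l IH]; first by rewrite bin0n mul0r sigma_nil.
have := congr1 (fun p => p.[l.+1%:R]) SE.
have sE (p : {poly rat}) : (shift p).[l.+1%:R] = p.[l%:R].
  by rewrite /shift horner_comp !hornerE -natr1 addrK.
rewrite /L hornerD hornerN hornerZ !hornerM !hornerD !sE !hornerE.
move=> E; rewrite sigma_down -IH -hT.
have b1 : l.+1%:R * 'C(l, j)%:R = j.+1%:R * 'C(l.+1, j.+1)%:R :> rat.
  by rewrite -!natrM mul_bin_diag.
have b2 : 'C(l.+1, j.+1)%:R = 'C(l, j.+1)%:R + 'C(l, j)%:R :> rat.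
  by rewrite binS natrD.
have l0 : l.+1%:R != 0 :> rat by rewrite pnatr_eq0.
apply: (mulfI l0).
set x := l.+1%:R in E b1 l0 *; set J := j.+1%:R in E b1 *.
set s := S.[x] in E *; set s' := S.[_] in E *; set t := T.[_] in E *.
have -> : x * ('C(l.+1, j.+1)%:R * s) = 'C(l.+1, j.+1)%:R * (x * s) by ring.
have {}E : x * s - (x - J) * s' = J * x * t := E.
have -> : x * s = (x - J) * s' + J * (x * t) by rewrite -[LHS](subrK ((x - J) * s')) E; ring.
have -> : 'C(l, j.+1)%:R = 'C(l.+1, j.+1)%:R - 'C(l, j)%:R :> rat.
  by rewrite b2 addrK.
have -> : x * (('C(l.+1, j.+1)%:R - 'C(l, j)%:R) * s' + x * ('C(l, j)%:R * t)) =
  x * 'C(l.+1, j.+1)%:R * s' - (x * 'C(l, j)%:R) * s' +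
  x * (x * 'C(l, j)%:R) * t by ring.
by rewrite b1; ring.
Qed.

End StirlingExistence.

Lemma stirling_poly_unique (j : nat) (S T : {poly rat}) :
  is_stirling_poly j S -> is_stirling_poly j T -> S = T.
Proof.
move=> hS hT; apply/eqP; rewrite -subr_eq0; apply/negPn/negP => ne.
pose rs : seq rat := [seq l%:R | l <- iota j.+1 (size (S - T))].
have := max_poly_roots ne (_ : all (root (S - T)) rs) (_ : uniq rs).
rewrite size_map size_iota ltnn => H; suff: false by [].
apply: H; last by rewrite map_inj_uniq ?iota_uniq // => x y /eqP; rewrite eqr_nat => /eqP.
apply/allP => _ /mapP[l + ->]; rewrite mem_iota => /andP[jl _].
have l0 : (0 < l)%N by apply: leq_ltn_trans jl.
have b0 : 'C(l, j)%:R != 0 :> rat by rewrite pnatr_eq0 -lt0n bin_gt0 ltnW.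
rewrite rootE hornerD hornerN subr_eq0; apply/eqP.
by apply: (mulfI b0); rewrite hS // hT.
Qed.

Definition stirling_poly (j : nat) : {poly rat} :=
  sval (stirling_poly_exists j).

Lemma stirling_polyP (j : nat) : is_stirling_poly j (stirling_poly j).
Proof. exact: svalP. Qed.

(* Main.v *)
(* An excited diagram of [m] is determined by the columns c_0 < ... < c_(m-1)
   of its pebbles: pebble t sits in row c_t - t. Deciding whether the first
   column carries a pebble gives, for cells and rows counted from (i, j), the
   recursion
     E_m(i, j) = h_(i,j) E_(m-1)(i, j+1) + E_m(i+1, j+1).
   The factorial elementary symmetric function
     e_m(x | s) = sum_(c_0 < ... < c_(m-1)) prod_t (x_(c_t) - s - (c_t - t))
   satisfies e_m(x, xs | s) = (x - s) e_(m-1)(xs | s) + e_m(xs | s + 1), is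
   symmetric in the x's and invariant under translating the x's and s together.
   The hook lengths of row i right of column j are those of row i+1 shifted by
   p + 1, together with 1, ..., p; since e_m(1, ..., p, xs | 1) = e_m(xs | p+1),
   both recursions agree and E_m is e_m(a | 0). Splitting off the last variable
   expands e_m(a | 0) in the sigma_i(a), with coefficients that satisfy the
   recurrence of the Stirling polynomials at negative integers. *)

Require Import Defs.
From mathcomp Require Import all_boot all_order all_algebra.
From mathcomp Require Import ring zify.

Set Implicit Arguments.
Unset Strict Implicit.
Unset Printing Implicit Defensive.

Import Order.TTheory GRing.Theory Num.Theory.
Local Open Scope ring_scope.

(** * Factorial elementary symmetric functions *)

Section FactorialElementary.
Variable R : comNzRingType.
Implicit Types (xs ys : seq R) (s t x : R).

(* With 0-based c, the sum over c_0 < ... < c_(m-1) of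
   prod_t (xs_(c_t) - s - (c_t - t)). *)
Fixpoint fesym xs (m : nat) s : R :=
  match m, xs with
  | 0, _ => 1
  | _.+1, [::] => 0
  | m'.+1, x :: xs' => (x - s) * fesym xs' m' s + fesym xs' m (s + 1)
  end.

Lemma fesym0 xs s : fesym xs 0 s = 1. Proof. by case: xs. Qed.

Lemma fesymS x xs m s :
  fesym (x :: xs) m.+1 s = (x - s) * fesym xs m s + fesym xs m.+1 (s + 1).
Proof. by []. Qed.

Lemma fesym_translate t xs m s :
  fesym [seq x + t | x <- xs] m (s + t) = fesym xs m s.
Proof.
elim: xs m s => [|x xs IH] [|m] s //.
rewrite map_cons !fesymS IH (_ : s + t + 1 = s + 1 + t) ?IH; last by ring.
by ring.
Qed.

(** Unfolding twice, [x] and [y] enter only through (x - s)(y - s) and x + y - 2s - 1. *)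
Lemma fesym_swap x y xs m s :
  fesym [:: x, y & xs] m s = fesym [:: y, x & xs] m s.
Proof.
by case: m => [|[|m]] //; rewrite !fesymS ?fesym0; ring.
Qed.

Lemma fesym_rcons_cons x xs m s :
  fesym (rcons xs x) m s = fesym (x :: xs) m s.
Proof.
elim: xs m s => [|y xs IH] [|m] s //.
by rewrite rcons_cons fesymS !IH -fesymS fesym_swap.
Qed.

(* A variable equal to s can be moved to the front, where its factor vanishes. *)
Lemma fesym_drop_consecutive xs p m s :
  fesym (xs ++ [seq s + i%:R | i <- rev (iota 0 p)]) m s = fesym xs m (s + p%:R).
Proof.
elim: p s => [|p IH] s; first by rewrite cats0 addr0.
rewrite /= (iotaDl 1 0 p : iota 1 p = _) rev_cons map_rcons -rcons_cat.
rewrite fesym_rcons_cons addr0; case: m IH => [|m] IH; first by rewrite !fesym0.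
rewrite fesymS subrr mul0r add0r -map_rev -map_comp.
rewrite (_ : map _ _ = [seq s + 1 + i%:R | i <- rev (iota 0 p)]).
  by rewrite IH -natr1; congr fesym; ring.
by apply: eq_map => i /=; rewrite natrD addrA.
Qed.

Lemma fesym_gt xs m s : (size xs < m)%N -> fesym xs m s = 0.
Proof.
elim: xs m s => [|x xs IH] [|m] s //= lt.
by rewrite !IH ?mulr0 ?addr0 // ltnW.
Qed.

(** The new summand has its last pebble, of index m, in column [size xs], whence the factor x - s -
    (size xs - m). *)
Lemma fesym_rcons x xs m s :
  fesym (rcons xs x) m.+1 s =
  fesym xs m.+1 s + (x - s - (size xs)%:R + m%:R) * fesym xs m s.
Proof.
elim: xs m s => [|y xs IH] [|m] s; rewrite ?rcons_cons ?fesymS ?fesym0.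
- by rewrite /=; ring.
- by rewrite /=; ring.
- by rewrite IH !fesym0 /= -[(size xs).+1%:R]natr1; ring.
by rewrite !IH /= -[(size xs).+1%:R]natr1 -[m.+1%:R]natr1; ring.
Qed.

End FactorialElementary.

(** * Stirling polynomials at negative integers *)

Lemma gbinom_nat N j : gbinom N%:R j = 'C(N, j)%:R.
Proof.
have j0 : j`!%:R != 0 :> rat by rewrite pnatr_eq0 -lt0n fact_gt0.
apply: (mulIf j0); rewrite /gbinom divfK // -natrM bin_ffact ffact_prod natr_prod.
have [lt|le] := ltnP N j.
  by rewrite (bigD1 (Ordinal lt)) //= subrr mul0r (bigD1 (Ordinal lt)) //= subnn mul0r.
by apply: eq_bigr => t _; rewrite natrB // (leq_trans (ltnW (ltn_ord t))).
Qed.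

Lemma poly_eq_large_nat (p q : {poly rat}) N :
  (forall l : nat, (N <= l)%N -> p.[l%:R] = q.[l%:R]) -> p = q.
Proof.
move=> pq; apply/eqP; rewrite -subr_eq0; apply/negPn/negP => ne.
have := max_poly_roots (rs := [seq l%:R | l <- iota N (size (p - q)%R)]) ne.
rewrite size_map size_iota ltnn => H; suff: false by [].
apply: H.
  apply/allP => _ /mapP[l + ->]; rewrite mem_iota => /andP[Nl _].
  by rewrite rootE hornerD hornerN subr_eq0 pq.
by rewrite map_inj_uniq ?iota_uniq // => x y /eqP; rewrite eqr_nat => /eqP.
Qed.

(** At large natural x this is [sigma_down]; being a polynomial identity, it extends to the negative
    x where it is used. *)
Lemma stirling_poly_rec j (x : rat) :
  x * (stirling_poly j.+1).[x] - (x - j.+1%:R) * (stirling_poly j.+1).[x - 1]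
  = j.+1%:R * x * (stirling_poly j).[x - 1].
Proof.
set S := stirling_poly j.+1; set T := stirling_poly j.
suff: 'X * S - ('X - j.+1%:R%:P) * (S \Po ('X - 1%:P))
      = j.+1%:R *: ('X * (T \Po ('X - 1%:P))).
  by move/(congr1 (fun p => p.[x])); rewrite !(hornerE, horner_comp).
(* The bound keeps x - 1 = l positive, as [stirling_polyP] requires, and C(l+1, j+1) nonzero. *)
apply: (@poly_eq_large_nat _ _ j.+2) => [[//|l] jl].
rewrite !(hornerE, horner_comp) -[in LHS]natr1 addrK natr1.
have l0 : (0 < l)%N by lia.
have := sigma_down j l.
rewrite -!stirling_polyP // -/S -/T.
have b1 : l.+1%:R * 'C(l, j)%:R = j.+1%:R * 'C(l.+1, j.+1)%:R :> rat.
  by rewrite -!natrM mul_bin_diag.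
have b2 : 'C(l.+1, j.+1)%:R = 'C(l, j.+1)%:R + 'C(l, j)%:R :> rat.
  by rewrite binS natrD.
have b0 : 'C(l.+1, j.+1)%:R != 0 :> rat by rewrite pnatr_eq0 -lt0n bin_gt0; lia.
move=> E; apply: (mulfI b0).
have -> : l.+1%:R - 1 = l%:R :> rat by rewrite -natr1 addrK.
set y : rat := l.+1%:R in E b1 *; set J : rat := j.+1%:R in b1 *.
set c := 'C(_, _)%:R in E b1 b2 b0 *.
set c1 := 'C(_, _)%:R in E b2; set c2 := 'C(_, _)%:R in E b1 b2.
set s := S.[y] in E *; set s' := S.[_] in E *; set t := T.[_] in E *.
have e1 : c1 = c - c2 by rewrite b2 addrK.
have -> : c * (y * s - (y - J) * s') = y * (c * s) - y * c * s' + (J * c) * s' by ring.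
transitivity (J * c * y * t); last by rewrite /=; ring.
by rewrite E e1 -b1; ring.
Qed.

(* Up to the sign (-1)^j this is the complete homogeneous polynomial
   h_j(1, ..., n). *)
Definition stirling_dual (n j : nat) : rat :=
  'C(n + j, j)%:R * (stirling_poly j).[- n.+1%:R].

Lemma stirling_dual0 n : stirling_dual n 0 = 1.
Proof.
rewrite /stirling_dual; have -> : stirling_poly 0 = 1.
  apply: (@stirling_poly_unique 0); first exact: stirling_polyP.
  by move=> l _; rewrite bin0 sigma0 hornerC mulr1.
by rewrite bin0 hornerC mulr1.
Qed.

(** At x = 0 the recurrence reduces to (j + 1) S_{j+1}(-1) = 0. *)
Lemma stirling_dual0S j : stirling_dual 0 j.+1 = 0.
Proof.
have := stirling_poly_rec j 0; rewrite !mul0r mulr0 mul0r !sub0r mulNr opprK.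
by rewrite /stirling_dual => /eqP; rewrite mulf_eq0 pnatr_eq0 /= => /eqP->; rewrite mulr0.
Qed.

(** Signed form of h_{j+1}(1..n+1) = h_{j+1}(1..n) + (n+1) h_j(1..n+1), obtained from
    [stirling_poly_rec] at x = -(n+1). *)
Lemma stirling_dual_rec n j :
  stirling_dual n.+1 j.+1 = stirling_dual n j.+1 - n.+1%:R * stirling_dual n.+1 j.
Proof.
have := stirling_poly_rec j (- n.+1%:R).
have -> : - n.+1%:R - 1 = - n.+2%:R :> rat by rewrite -opprD natr1.
rewrite /stirling_dual.
have b1 : (n.+1 + j.+1)%:R * 'C(n.+1 + j, j)%:R = j.+1%:R * 'C(n.+1 + j.+1, j.+1)%:R :> rat.
  by rewrite -!natrM !addnS mul_bin_diag.
have b2 : 'C(n.+1 + j.+1, j.+1)%:R = 'C(n + j.+1, j.+1)%:R + 'C(n.+1 + j, j)%:R :> rat.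
  by rewrite addSn binS natrD addnS.
have b0 : (n.+1 + j.+1)%:R != 0 :> rat by rewrite pnatr_eq0.
have -> : - n.+1%:R - j.+1%:R = - (n.+1 + j.+1)%:R :> rat by rewrite natrD; ring.
set d : rat := (n.+1 + j.+1)%:R in b1 b0 *.
have dE : d = n.+1%:R + j.+1%:R by rewrite /d natrD.
move: b1 b2; set c := 'C(n.+1 + j.+1, _)%:R; set c1 := 'C(_, _)%:R; set c2 := 'C(_, _)%:R.
set s := (stirling_poly j.+1).[_]; set s' := (stirling_poly j.+1).[_].
set t := (stirling_poly j).[_] => b1 b2 E.
(* The factor n + j + 2 is the coefficient of S_{j+1}(x - 1) in the recurrence at this x. *)
apply: (mulfI b0).
have {}E : d * s' = n.+1%:R * s - j.+1%:R * n.+1%:R * t.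
  apply/eqP; rewrite -subr_eq0; apply/eqP; move/eqP: E.
  by rewrite -subr_eq0 => /eqP <-; ring.
have {}b2 : c2 = c - c1 by rewrite b2 addrK.
rewrite mulrCA E b2.
have -> : d * ((c - c1) * s - n.+1%:R * (c1 * t)) = (d * c - d * c1) * s - n.+1%:R * (d * c1 * t) by ring.
by rewrite b1 dE; ring.
Qed.

(** * Expansion in elementary symmetric polynomials *)

Lemma sigma_rcons j c s :
  sigma j.+1 (rcons s c) = sigma j.+1 s + c * sigma j s.
Proof.
elim: s j => [|x s IH] j; first by rewrite /= sigma_cons.
case: j => [|j]; rewrite rcons_cons !sigma_cons !IH ?sigma0; by ring.
Qed.

Lemma sum_stirling_dual_rec (f : nat -> rat) n m :
  \sum_(i < m.+2) stirling_dual n.+1 (m.+1 - i) * f i =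
  \sum_(i < m.+2) stirling_dual n (m.+1 - i) * f i
  - n.+1%:R * \sum_(i < m.+1) stirling_dual n.+1 (m - i) * f i.
Proof.
rewrite big_ord_recr [in RHS]big_ord_recr /= subnn !stirling_dual0.
rewrite addrAC mulr_sumr -sumrB; congr (_ + _); apply: eq_bigr => i _.
rewrite subSn; last by rewrite -ltnS.
by rewrite stirling_dual_rec mulrBl mulrA.
Qed.

Lemma sum_stirling_dual_eq0 (f : nat -> rat) m :
  \sum_(i < m.+1) stirling_dual 0 (m - i) * f i = f m.
Proof.
rewrite big_ord_recr /= subnn stirling_dual0 mul1r big1 ?add0r // => i _.
by rewrite -[(m - i)%N]prednK ?subn_gt0 // stirling_dual0S mul0r.
Qed.

(** Induction on the last variable x: with n = size xs - m, [fesym_rcons] brings the factor x - n,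
    whose x part matches [sigma_rcons] and whose -n part matches [sum_stirling_dual_rec]. *)
Lemma fesym_stirling_dual (xs : seq rat) m : (m <= size xs)%N ->
  fesym xs m 0 =
  \sum_(i < m.+1) stirling_dual (size xs - m) (m - i) * sigma i xs.
Proof.
elim/last_ind: xs m => [|xs x IH] [|m].
- by rewrite big_ord1 stirling_dual0 sigma0 mulr1.
- by [].
- by rewrite fesym0 big_ord1 stirling_dual0 sigma0 mulr1.
rewrite size_rcons ltnS subSS => le.
have -> : \sum_(i < m.+2) stirling_dual (size xs - m) (m.+1 - i) * sigma i (rcons xs x)
    = \sum_(i < m.+2) stirling_dual (size xs - m) (m.+1 - i) * sigma i xs
      + x * \sum_(i < m.+1) stirling_dual (size xs - m) (m - i) * sigma i xs.
  rewrite big_ord_recl [in RHS]big_ord_recl !sigma0 mulr_sumr -addrA -big_split.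
  congr (_ + _); apply: eq_bigr => i _.
  by rewrite lift0 subSS sigma_rcons mulrDr mulrCA.
rewrite fesym_rcons (IH m) // subr0.
have -> : x - (size xs)%:R + m%:R = x - (size xs - m)%:R by rewrite natrB //; ring.
have [lt|ge] := ltnP m (size xs).
  by rewrite IH // -(subnSK lt) (sum_stirling_dual_rec (sigma^~ xs)); ring.
(* Here m = size xs, so n = 0 and both sides are x sigma_m(xs). *)
rewrite fesym_gt // (eqP (_ : (size xs - m)%N == 0)) ?subn_eq0 //.
by rewrite !(sum_stirling_dual_eq0 (sigma^~ xs)) (@sigma_gt m.+1) // subr0 !add0r.
Qed.

(** * Excited diagrams as words *)

Section Words.
Local Open Scope nat_scope.
Variable la : seq nat.
Hypothesis la_sorted : sorted geq la.
Let k := nth 0 la 0.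
Implicit Types (w u v : bitseq) (i j m : nat).

Lemma nth_sorted_geq i i' : i <= i' -> nth 0 la i' <= nth 0 la i.
Proof.
move=> le; have [lt|ge] := ltnP i' (size la); last by rewrite nth_default.
apply: (@sorted_leq_nth _ geq) => //; try exact: (leq_ltn_trans le).
- by move=> y x z /= yx zy; exact: leq_trans yx.
- by move=> x /=.
Qed.

Lemma in_diagram_size i j : in_diagram la i j -> i < size la.
Proof. by rewrite /in_diagram; apply: contraLR; rewrite -!leqNgt => le; rewrite nth_default. Qed.

Lemma in_diagram_le i j i' j' :
  i' <= i -> j' <= j -> in_diagram la i j -> in_diagram la i' j'.
Proof.
rewrite /in_diagram => ii jj lt.
by rewrite (leq_ltn_trans jj) // (leq_trans lt) // nth_sorted_geq.
Qed.

(* A word w encodes a pebble configuration: column j carries a pebble iff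
   w_j is true, and that pebble lies in row count negb (take j w), one step
   down for every empty column on its left. *)
Definition word_cells w : {set cell la} :=
  [set c : cell la | nth false w c.2 && (c.1 == count negb (take c.2 w) :> nat)].

(** The pair (i, j) is where a pebble on the first letter would lie; an empty column lowers the row
    of all later ones. *)
Fixpoint word_fits i j w : bool :=
  if w is b :: w' then (b ==> in_diagram la i j) && word_fits (i + ~~ b) j.+1 w'
  else true.

Lemma word_fits_cat i j u v :
  word_fits i j (u ++ v) =
  word_fits i j u && word_fits (i + count negb u) (j + size u) v.
Proof.
elim: u i j => [|b u IH] i j /=; first by rewrite !addn0.
by rewrite IH andbA addnA addnS addSn.
Qed.

Lemma word_fits_nth i j w t : word_fits i j w -> nth false w t ->
  in_diagram la (i + count negb (take t w)) (j + t).
Proof.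
elim: w i j t => [|b w IH] i j [|t] //= /andP[].
  by case: b => //= h _ _; rewrite !addn0.
by move=> _ h1 h2; have := IH _ _ _ h1 h2; rewrite addnA addnS addSn.
Qed.

(** The size and fit conditions keep every pebble inside the bounding box, so [word_cells] loses
    none. *)
Lemma word_cells_occupied w i j :
  size w = k -> word_fits 0 0 w ->
  occupied (word_cells w) i j = nth false w j && (i == count negb (take j w)).
Proof.
move=> sw fw; apply/existsP/andP => [[c /andP[]]|[wj /eqP ->]].
  by rewrite inE => /andP[wc c1] /andP[/eqP <- /eqP <-].
have jk : j < k by rewrite -sw; apply: contraLR wj; rewrite -leqNgt => le; rewrite nth_default.
have il := in_diagram_size (word_fits_nth fw wj).
by exists (Ordinal il, Ordinal jk); rewrite !inE /= add0n wj !eqxx.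
Qed.

Lemma word_cells_inj w w' :
  size w = k -> size w' = k -> word_fits 0 0 w -> word_fits 0 0 w' ->
  word_cells w = word_cells w' -> w = w'.
Proof.
move=> sw sw' fw fw' E; apply: (@eq_from_nth _ false); rewrite ?sw ?sw' // => j _.
apply/idP/idP => h.
  have : occupied (word_cells w) (count negb (take j w)) j.
    by rewrite word_cells_occupied // h eqxx.
  by rewrite E word_cells_occupied // => /andP[].
have : occupied (word_cells w') (count negb (take j w')) j.
  by rewrite word_cells_occupied // h eqxx.
by rewrite -E word_cells_occupied // => /andP[].
Qed.

(** The prefix before any other column contains both swapped letters or neither, so all other
    pebbles stay in place. *)
Lemma nth_take_swap u b b' v j :
  j != size u -> j != (size u).+1 ->
  nth false (u ++ [:: b, b' & v]) j = nth false (u ++ [:: b', b & v]) j /\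
  count negb (take j (u ++ [:: b, b' & v])) = count negb (take j (u ++ [:: b', b & v])).
Proof.
move=> n1 n2; rewrite !nth_cat !take_cat; case: ltnP => // le.
rewrite !count_cat; have -> : j - size u = (j - size u - 2).+2 by lia.
by rewrite /=; split=> //; rewrite (addnCA (~~ b)).
Qed.

(** Swapping [true, false] moves the pebble one column right and puts one more empty column on its
    left, hence one row down. *)
Lemma word_cells_move u v (c c' : cell la) :
  c.1 = count negb u :> nat -> c.2 = size u :> nat ->
  c'.1 = c.1.+1 :> nat -> c'.2 = c.2.+1 :> nat ->
  word_cells (u ++ [:: false, true & v]) =
  c' |: (word_cells (u ++ [:: true, false & v]) :\ c).
Proof.
move=> c1 c2 c1' c2'; apply/setP => -[e1 e2]; rewrite !inE /=.
have eqc (d : cell la) : ((e1, e2) == d) = (e1 == d.1 :> nat) && (e2 == d.2 :> nat).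
  by case: d => d1 d2; rewrite xpair_eqE.
rewrite !eqc c1' c2' c1 c2.
have [E|n1] := eqVneq (e2 : nat) (size u).
  rewrite E !take_size_cat // !nth_cat ltnn subnn /= andbT andNb orbF.
  by rewrite [size u == _]eqn_leq ltnn !andbF.
have [E|n2] := eqVneq (e2 : nat) (size u).+1.
  rewrite E !nth_cat !take_cat ltnNge leqnSn /= subSnn /= !count_cat /= !andbT.
  by rewrite !addn0 addn1 !andbF orbF.
rewrite (nth_take_swap false true v n1 n2).1 (nth_take_swap false true v n1 n2).2.
by rewrite !andbF.
Qed.

(** Stated from the target word because it serves to undo moves; the source fits since the diagram
    is closed under going up and left. *)
Lemma excited_move_word u v :
  let w' := u ++ [:: false, true & v] in
  size w' = k -> word_fits 0 0 w' ->
  word_fits 0 0 (u ++ [:: true, false & v]) /\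
  excited_move (word_cells (u ++ [:: true, false & v])) (word_cells w').
Proof.
move=> w' sw' fw'; set w := u ++ _.
have sw : size w = k by rewrite -sw' !size_cat.
have := fw'; rewrite word_fits_cat /= !add0n addn1 addn0 => /and3P[fu d' fv].
have d : in_diagram la (count negb u) (size u).
  exact: in_diagram_le (leqnSn _) (leqnSn _) d'.
have fw : word_fits 0 0 w by rewrite word_fits_cat /= !add0n addn0 addn1 fu d.
split=> //.
have jk : (size u).+1 < k by rewrite -sw' size_cat /=; lia.
have il' := in_diagram_size d'.
pose c : cell la := (Ordinal (ltnW il'), Ordinal (ltnW jk)).
pose c' : cell la := (Ordinal il', Ordinal jk).
apply/existsP; exists c; apply/existsP; exists c'; apply/and5P; split=> //=.
- by rewrite inE /= nth_cat ltnn subnn take_size_cat //= eqxx.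
- by rewrite !eqxx.
(* The two cells tested in column [size u + 1] are vacant because that column is empty, the one
   below [c] because its column holds only [c]. *)
- have nj : nth false w (size u).+1 = false.
    by rewrite nth_cat ltnNge leqnSn /= subSnn.
  rewrite !word_cells_occupied // nj (take_size_cat _ (erefl (size u))) /=.
  by rewrite eqn_leq ltnn andbF.
- by apply/eqP; exact: word_cells_move.
Qed.

Lemma excited_move_wordP w (D : {set cell la}) :
  size w = k -> word_fits 0 0 w -> excited_move (word_cells w) D ->
  exists u v, [/\ w = u ++ [:: true, false & v],
    word_fits 0 0 (u ++ [:: false, true & v]) &
    D = word_cells (u ++ [:: false, true & v])].
Proof.
move=> sw fw /existsP[c /existsP[c' /and5P[cw /andP[/eqP c1 /eqP c2] d' no /eqP ->]]].
move: cw; rewrite inE => /andP[wc /eqP rc].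
have jw : c.2.+1 < size w by rewrite sw -c2.
have wE : w = take c.2 w ++ [:: true, nth false w c.2.+1 & drop c.2.+2 w].
  by rewrite -[in LHS](cat_take_drop c.2 w) (drop_nth false) 1?ltnW // wc (drop_nth false).
(* A pebble in the next column would follow the letter [true], hence lie in the row of [c], on a
   cell that the move needs vacant. *)
have nb : nth false w c.2.+1 = false.
  apply/negP => wj; case/and3P: no => + _ _.
  rewrite word_cells_occupied // wj (take_nth false) 1?ltnW // wc.
  by rewrite -cats1 count_cat /= !addn0 rc eqxx.
rewrite {}nb in wE; move: wE; set u := take _ _; set v := drop _ _ => wE.
have su : size u = c.2 by rewrite size_take ltnW.
have dE : in_diagram la (count negb u).+1 (size u).+1 by rewrite -rc su -c1 -c2.
exists u, v; split=> //.
  move: fw; rewrite wE !word_fits_cat /= !add0n !addn0 !addn1 dE.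
  by case/and3P=> -> _ ->.
by rewrite {1}wE; apply/esym/word_cells_move.
Qed.

(** For a word this is the sum of the rows of its pebbles, counted from 0, so every move raises it
    by one. *)
Fixpoint inversions w : nat :=
  if w is b :: w' then (if b then 0 else count id w') + inversions w' else 0.

Lemma inversions_swap u v :
  inversions (u ++ [:: false, true & v]) = (inversions (u ++ [:: true, false & v])).+1.
Proof.
elim: u => [|b u IH] /=; first by lia.
by rewrite IH !count_cat /= addnS.
Qed.

Lemma word_sorted_or_swap w :
  w = nseq (count id w) true ++ nseq (size w - count id w) false
  \/ exists u v, w = u ++ [:: false, true & v].
Proof.
elim: w => [|b w [IH|[u [v ->]]]]; first by left.
  case: b; first by left; rewrite /= {1}IH.
  rewrite /= add0n; case: (count id w) IH => [|n] IH.
    by left; rewrite subn0 {1}IH subn0.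
  by right; exists [::], (behead w); rewrite IH.
by right; exists (b :: u), v.
Qed.

Lemma one_row_word m : m <= k ->
  one_row la m = word_cells (nseq m true ++ nseq (k - m) false).
Proof.
move=> mk; apply/setP => -[e1 e2]; rewrite !inE /= nth_cat size_nseq !nth_nseq.
rewrite take_cat size_nseq; case: ltnP => lt; last by rewrite andbF if_same.
by rewrite take_nseq 1?ltnW // count_nseq mul0n andbT.
Qed.

Lemma one_row_word_fits m : m <= k ->
  word_fits 0 0 (nseq m true ++ nseq (k - m) false).
Proof.
move=> mk; rewrite word_fits_cat; apply/andP; split.
  suff H j : j + m <= k -> word_fits 0 j (nseq m true) by exact: H.
  elim: m {mk} j => [|m IH] j //= jm.
  by rewrite IH ?addSnnS // andbT /in_diagram (leq_trans _ jm) // addnS ltnS leq_addr.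
by elim: (k - m) (_ + _) (_ + _) => //= n IH i j; rewrite IH.
Qed.

(** Moves preserve the word form and the number of pebbles; conversely, undoing moves lowers
    [inversions] until the starting word is reached. *)
Lemma excited_wordP m (D : {set cell la}) : m <= k ->
  reflect (exists w, [/\ size w = k, count id w = m, word_fits 0 0 w & D = word_cells w])
          (D \in excited la m).
Proof.
move=> mk; rewrite inE (one_row_word mk); apply: (iffP idP).
  case/connectP => p + ->.
  have : exists w, [/\ size w = k, count id w = m, word_fits 0 0 w &
      word_cells (nseq m true ++ nseq (k - m) false) = word_cells w].
    exists (nseq m true ++ nseq (k - m) false); split; last by [].
    - by rewrite size_cat !size_nseq subnKC.
    - by rewrite count_cat !count_nseq mul1n mul0n addn0.
    - exact: one_row_word_fits.
  elim: p (word_cells _) => [|D1 p IH] D0 //= [w [sw cw fw ->]] /andP[mv].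
  have [u [v [wE fw' ->]]] := excited_move_wordP sw fw mv.
  apply: IH; exists (u ++ [:: false, true & v]); split=> //.
    by rewrite -sw wE !size_cat.
  by rewrite -cw wE !count_cat /= addnCA.
case=> w [sw cw fw ->].
have [n] := ubnP (inversions w); elim: n w sw cw fw => // n IH w sw cw fw.
case: (word_sorted_or_swap w) => [wE|[u [v wE]]] lt.
  by rewrite wE sw cw connect0.
rewrite wE in sw cw fw lt *; have [fw' mv] := excited_move_word sw fw.
apply: connect_trans (connect1 mv); apply: IH => //.
- by rewrite -sw !size_cat.
- by rewrite -cw !count_cat /=; lia.
- by rewrite inversions_swap in lt.
Qed.

(** * Weighted enumeration of words *)

Fixpoint words r i j m : seq bitseq :=
  if r is r'.+1 then
    (if m is m'.+1 then
       if in_diagram la i j then [seq true :: w | w <- words r' i j.+1 m'] else [::]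
     else [::])
    ++ [seq false :: w | w <- words r' i.+1 j.+1 m]
  else if m is 0 then [:: [::]] else [::].

Lemma mem_words r i j m w :
  (w \in words r i j m) = [&& size w == r, count id w == m & word_fits i j w].
Proof.
have cons_mem b b' w' s : (b :: w' \in [seq b' :: x | x <- s]) = (b == b') && (w' \in s).
  apply/mapP/andP => [[x xs [-> ->]]|[/eqP-> ws]]; first by [].
  by exists w'.
have nil_mem b s : ([::] \in [seq b :: x | x <- s]) = false by apply/mapP=> -[].
elim: r i j m w => [|r IH] i j m [|b w] /=; try by case: m.
  by rewrite mem_cat nil_mem orbF; case: m => [|m] //; case: ifP; rewrite ?nil_mem.
rewrite mem_cat cons_mem IH eqSS; case: b => /=; rewrite ?orbF ?addn1 ?addn0 //.
  case: m => [|m]; first by rewrite andbF.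
  case: ifP => _; last by rewrite !andbF.
  by rewrite cons_mem IH add1n eqSS.
case: m => [|m] //; case: ifP => _ //.
by rewrite cons_mem.
Qed.

Lemma words_uniq r i j m : uniq (words r i j m).
Proof.
elim: r i j m => [|r IH] i j [|m] //=.
  by rewrite map_inj_uniq // => x y [].
rewrite cat_uniq; apply/and3P; split.
- by case: ifP => _ //; rewrite map_inj_uniq // => x y [].
- by apply/hasPn => _ /mapP[x _ ->]; case: ifP => _ //; apply/mapP => -[].
- by rewrite map_inj_uniq // => x y [].
Qed.

Fixpoint word_weight i j w : nat :=
  if w is b :: w' then
    (if b then hook_length la i j else 1) * word_weight (i + ~~ b) j.+1 w'
  else 1.

Lemma word_weightE i j w : word_weight i j w =
  \prod_(t < size w | nth false w t) hook_length la (i + count negb (take t w)) (j + t).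
Proof.
elim: w i j => [|b w IH] i j /=; first by rewrite big_ord0.
rewrite IH [RHS]big_mkcond big_ord_recl /= !addn0; congr (_ * _).
rewrite [LHS]big_mkcond; apply: eq_bigr => t _; rewrite /= /bump /= add1n /=.
by rewrite addnA addnS addSn.
Qed.

(** Each column holds at most one pebble, so the product over cells becomes one over columns. *)
Lemma prod_word_cells w : size w = k -> word_fits 0 0 w ->
  \prod_(c in word_cells w) hook_length la c.1 c.2 = word_weight 0 0 w.
Proof.
move=> sw fw; rewrite word_weightE sw.
transitivity (\prod_(i < size la) \prod_(j < k |
    nth false w j && (i == count negb (take j w) :> nat)) hook_length la i j).
  by rewrite pair_big_dep; apply: eq_bigl => -[i j]; rewrite inE.
rewrite (exchange_big_dep (fun j : 'I_k => nth false w j)) /=; last by move=> i j _ /andP[].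
apply: eq_bigr => j wj.
have il := in_diagram_size (word_fits_nth fw wj).
by rewrite (big_pred1 (Ordinal il)) // => i; rewrite wj.
Qed.

Fixpoint words_sum r i j m : nat :=
  match r, m with
  | _, 0 => 1
  | 0, _.+1 => 0
  | r'.+1, m'.+1 =>
    (if in_diagram la i j then hook_length la i j * words_sum r' i j.+1 m' else 0)
    + words_sum r' i.+1 j.+1 m
  end.

Lemma words_sumE r i j m :
  \sum_(w <- words r i j m) word_weight i j w = words_sum r i j m.
Proof.
elim: r i j m => [|r IH] i j [|m] /=; rewrite ?big_nil ?big_seq1 //.
  rewrite big_map -[RHS](_ : words_sum r i.+1 j.+1 0 = 1); last by case: (r).
  by rewrite -IH; apply: eq_bigr => w _; rewrite /= mul1n addn1.
rewrite big_cat; congr (_ + _).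
  case: ifP => _; last by rewrite big_nil.
  by rewrite big_map -IH big_distrr; apply: eq_bigr => w _; rewrite /= addn0.
by rewrite big_map -IH; apply: eq_bigr => w _; rewrite /= mul1n addn1.
Qed.

Lemma excited_sum_words m : m <= k -> excited_sum la m = words_sum k 0 0 m.
Proof.
move=> mk; rewrite /excited_sum mk -words_sumE.
rewrite [RHS]big_seq; under [RHS]eq_bigr => w.
  rewrite mem_words => /and3P[/eqP sw _ fw]; rewrite -prod_word_cells //; over.
(* Reindexed along [word_cells], the sum runs over a duplicate-free list with the same members as
   [excited la m]. *)
rewrite -[RHS]big_seq -(big_map word_cells xpredT
  (fun D : {set cell la} => \prod_(c in D) hook_length la c.1 c.2)).
rewrite big_uniq /=.
  apply: eq_bigl => D; apply/excited_wordP/mapP => // -[w].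
    by case=> sw cw fw ->; exists w; rewrite // mem_words sw cw fw !eqxx.
  by rewrite mem_words => /and3P[/eqP sw /eqP cw fw] ->; exists w.
rewrite map_inj_in_uniq ?words_uniq // => w w'.
rewrite !mem_words => /and3P[/eqP sw _ fw] /and3P[/eqP sw' _ fw'].
exact: word_cells_inj.
Qed.

End Words.

(** * Hook lengths of consecutive rows *)

Section Hooks.
Variable la : seq nat.
Hypothesis la_sorted : sorted geq la.
Local Notation row i := (nth 0%N la i).

Lemma leg_length_eq0 i j : (row i.+1 <= j)%N -> leg_length la i j = 0%N.
Proof.
move=> le; apply/eqP; rewrite eqn0Ngt -has_count; apply/hasPn => x /(nthP 0%N)[t _ <-].
by rewrite nth_drop -leqNgt (leq_trans _ le) // nth_sorted_geq // leq_addr.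
Qed.

Lemma leg_lengthS i j : (j < row i.+1)%N ->
  leg_length la i j = (leg_length la i.+1 j).+1.
Proof.
move=> lt; rewrite /leg_length (drop_nth 0%N) /= ?lt //.
exact: (@in_diagram_size _ _ j).
Qed.

Lemma hook_length_short i j : (row i.+1 <= j < row i)%N ->
  hook_length la i j = (row i - j)%N.
Proof.
by case/andP=> le lt; rewrite /hook_length leg_length_eq0 // /arm_length; lia.
Qed.

Lemma hook_lengthS i j : (j < row i.+1)%N ->
  hook_length la i j = (hook_length la i.+1 j + (row i - row i.+1).+1)%N.
Proof.
move=> lt; have := nth_sorted_geq la_sorted (leqnSn i).
by rewrite /hook_length leg_lengthS // /arm_length; lia.
Qed.

Definition row_hooks i j : seq rat :=
  [seq (hook_length la i c)%:R | c <- iota j (row i - j)].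

(** The columns of row i beyond row i+1 have hooks p, ..., 1. Dropping them turns s = 1 into 1 + p,
    which is also the hook difference in the common columns, so a translation removes it. *)
Lemma fesym_row_hooks_succ i j m :
  fesym (row_hooks i j.+1) m 1 = fesym (row_hooks i.+1 j.+1) m 0.
Proof.
have le := nth_sorted_geq la_sorted (leqnSn i).
(* The maximum restricts the count to columns from j+1 on, in case row i+1 ends earlier. *)
pose p := (row i - maxn j.+1 (row i.+1))%N.
have -> : row_hooks i j.+1 =
    [seq (hook_length la i c)%:R | c <- iota j.+1 (row i.+1 - j.+1)]
    ++ [seq 1 + t%:R | t <- rev (iota 0 p)].
  rewrite /row_hooks (_ : row i - j.+1 = (row i.+1 - j.+1) + p)%N; last by rewrite /p; lia.
  rewrite iotaD map_cat; congr (_ ++ _).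
  apply: (@eq_from_nth _ 0); rewrite !size_map ?size_rev !size_iota // => t tp.
  rewrite (nth_map 0%N) ?size_iota // (nth_map 0%N) ?size_rev ?size_iota //.
  rewrite nth_rev ?size_iota // !nth_iota //; last by lia.
  rewrite nat1r hook_length_short; first by congr _%:R; lia.
  by rewrite /p in tp *; lia.
rewrite fesym_drop_consecutive -[RHS](fesym_translate (1 + p%:R)) add0r.
(* If row i+1 has no column from j+1 on, both lists are empty; otherwise p = row i - row i+1. *)
have [gt|ge] := leqP (row i.+1) j.+1.
  by rewrite /row_hooks (eqP (_ : (row i.+1 - j.+1 == 0)%N)) ?subn_eq0.
congr fesym; rewrite /row_hooks -map_comp; apply/eq_in_map => c.
rewrite mem_iota => c_in /=; rewrite hook_lengthS; last by lia.
by rewrite natrD nat1r; congr (_ + _%:R); rewrite /p; lia.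
Qed.

(** The hypothesis says that r columns suffice to reach the end of row i. Passing to cell (i+1, j+1)
    corresponds to s becoming s + 1, by [fesym_row_hooks_succ]. *)
Lemma words_sum_fesym r i j m : (row i <= j + r)%N ->
  (words_sum la r i j m)%:R = fesym (row_hooks i j) m 0.
Proof.
elim: r i j m => [|r IH] i j [|m] le; rewrite ?fesym0 //.
  by rewrite /row_hooks (_ : row i - j = 0)%N //; lia.
rewrite /= /in_diagram natrD IH; last first.
  by rewrite addSnnS (leq_trans _ le) // nth_sorted_geq.
rewrite -fesym_row_hooks_succ; case: ltnP => h.
  rewrite natrM IH ?addSnnS // /row_hooks.
  rewrite (_ : row i - j = (row i - j.+1).+1)%N; last by lia.
  by rewrite /= subr0 add0r.
have e c : (row i <= c)%N -> row_hooks i c = [::].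
  by move=> hc; rewrite /row_hooks (eqP (_ : row i - c == 0)%N) ?subn_eq0.
by rewrite !e ?addr0 // leqW.
Qed.

End Hooks.

Theorem theorem4p2 (n : nat) (la : seq nat) (n_gt0 : (0 < n)%N)
    (la_part : is_partition n la) (m : nat) :
  let k : nat := nth 0%N la 0 in
  let a : seq rat := [seq (hook_length la 0 j)%:R | j <- iota 0 k] in
  (excited_sum la m)%:R =
  \sum_(i < m.+1)
    gbinom (k%:R - i%:R) (m - i)
    * (stirling_poly (m - i)).[m%:R - k%:R - 1]
    * sigma i a.
Proof.
move=> k a; have /and3P[la_sorted _ _] := la_part.
have sa : size a = k by rewrite size_map size_iota.
(* For m > k the left side is 0 by convention; on the right the binomial vanishes for i <= k and
   sigma_i for i > k. *)
have [lt|le] := ltnP k m.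
  rewrite /excited_sum leqNgt lt /= big1 // => i _.
  have [ik|ki] := leqP i k; last by rewrite sigma_gt ?sa // mulr0.
  by rewrite -natrB // gbinom_nat bin_small ?mul0r ?ltn_sub2r // (leq_ltn_trans ik).
rewrite excited_sum_words // words_sum_fesym //.
rewrite /row_hooks subn0 -/k -/a fesym_stirling_dual ?sa //.
apply: eq_bigr => i _; have im : (i <= m)%N by rewrite -ltnS.
rewrite /stirling_dual -natrB ?(leq_trans im) // gbinom_nat.
(* This identifies the binomial with that of [stirling_dual (k - m) (m - i)]; the evaluation point
   is -(k - m + 1) = m - k - 1. *)
have -> : (k - i = k - m + (m - i))%N by lia.
by congr (_ * _.[_] * _); rewrite -natr1 natrB //; ring.
Qed.
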